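(* Let $n\ge 2$ and $N=\binom n2$. A real skew-symmetric $n\times n$ matrix $A$ is totally positive if and only if \[ M_{j,k}(A)>0\qquad\text{for all } 1\le j\le k\le n-1 . \] Moreover this test is minimal: $\mathcal{SS}_n^{>0}$ cannot be described as $\{A\in\mathcal{SS}_n : f_1(A)>0,\dots,f_r(A)>0\}$ by regular (polynomial) functions $f_1,\dots,f_r$ with $r<N$, whereas the test above uses exactly $N$ inequalities.
   Context: Fix $n\ge 2$, $N=\binom n2$. $\mathcal{SS}_n$ denotes the space of real skew-symmetric $n\times n$ matrices. Let $E_{a,b}$ be the $2n\times 2n$ matrix unit. For $t\in\mathbb R$ put $x_i(t)=\mathrm{Id}_{2n}+tE_{i,i+1}-tE_{n+i+1,n+i}$ for $1\le i\le n-1$, and $x_n(t)=\mathrm{Id}_{2n}+tE_{n-1,2n}-tE_{n,2n-1}$; these lie in $\mathrm{SO}(2n)$, the special orthogonal group of the symmetric bilinear form $q(x,y)=\sum_{i=1}^n (x_iy_{n+i}+y_ix_{n+i})$ on $\mathbb R^{2n}$. Let $(i_1,\dots,i_N)$ be the sequence obtained by concatenating, for $m=1,2,\dots,\lfloor n/2\rfloor$ in order, the three blocks ''$n$'', ''$n-2,n-3,\dots,2m-1$'', ''$n-1,n-2,\dots,2m$'' (a decreasing run $a,a-1,\dots,b$ is empty if $a<b$); e.g. for $n=4$ it is $4,2,1,3,2,4$ and for $n=5$ it is $5,3,2,1,4,3,2,5,3,4$. For $t=(t_1,\dots,t_N)\in\mathbb R^N$ let $X(t)$ be the $n\times 2n$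 matrix formed by the first $n$ rows of $x_{i_1}(t_1)x_{i_2}(t_2)\cdots x_{i_N}(t_N)$. Writing $X(t)=[U(t)\mid R(t)]$ with $U(t)$ the left $n\times n$ block (which is upper unitriangular), set $A(t)=U(t)^{-1}R(t)$; then $\mathrm{rowspan}\,X(t)=\mathrm{rowspan}[\mathrm{Id}_n\mid A(t)]$ and $A(t)$ is skew-symmetric with polynomial entries in $t$. A matrix $A\in\mathcal{SS}_n$ is called totally positive if $A=A(t)$ for some $t\in\mathbb R_{>0}^N$ (this is Lusztig total positivity of $\mathrm{rowspan}[\mathrm{Id}_n\mid A]$ in the orthogonal Grassmannian $\mathrm{OGr}(n,2n)$); $\mathcal{SS}_n^{>0}$ is the set of totally positive matrices. For an $n\times n$ matrix $A$ and $1\le j\le k\le n-1$, define \[ M_{j,k}(A)=(-1)^{jk}\det\Big(A_{\{1,\dots,n-k-1\}\cup\{n-k+j,\dots,n\}}^{\{1,\dots,n-j\}}\Big), \] the (signed) determinant of the submatrix of $A$ with rows $\{1,\dots,n-k-1,n-k+j,\dots,n\}$ and columns $\{1,\dots,n-j\}$. *)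

(* Defs.v *)
From HB Require Import structures.
From mathcomp Require Import all_boot all_order all_algebra.
From mathcomp Require Import reals.
From mathcomp Require Import mpoly.

Set Implicit Arguments.
Unset Strict Implicit.
Unset Printing Implicit Defensive.

Import Order.TTheory GRing.Theory Num.Theory.
Local Open Scope ring_scope.

Section Defs.
Variable R : realType.
Variable n : nat.

Definition Eu (a b : nat) : 'M[R]_(n + n) :=
  \matrix_(i, j) ((i.+1 == a) && (j.+1 == b))%:R.

Definition xgen (i : nat) (t : R) : 'M[R]_(n + n) :=
  if i == n then 1%:M + t *: Eu n.-1 (n + n) - t *: Eu n (n + n).-1
  else 1%:M + t *: Eu i i.+1 - t *: Eu (n + i.+1) (n + i).

Definition decrun (a b : nat) : seq nat := rev (iota b (a.+1 - b)).

Definition word : seq nat :=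
  flatten [seq [:: n] ++ decrun (n - 2) (2 * m).-1 ++ decrun n.-1 (2 * m)
          | m <- iota 1 n./2].

Definition xprod (t : 'I_'C(n, 2) -> R) : 'M[R]_(n + n) :=
  \prod_(k < 'C(n, 2)) xgen (nth 0%N word k) (t k).

Definition Xmat (t : 'I_'C(n, 2) -> R) : 'M[R]_(n, n + n) := usubmx (xprod t).
Definition Umat (t : 'I_'C(n, 2) -> R) : 'M[R]_n := lsubmx (Xmat t).
Definition Rmat (t : 'I_'C(n, 2) -> R) : 'M[R]_n := rsubmx (Xmat t).
Definition Amat (t : 'I_'C(n, 2) -> R) : 'M[R]_n := invmx (Umat t) *m Rmat t.

Definition skew_symmetric (A : 'M[R]_n) : Prop := A^T = - A.

Definition totally_positive (A : 'M[R]_n) : Prop :=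
  exists t : 'I_'C(n, 2) -> R, (forall k, 0 < t k) /\ A = Amat t.

Definition mxget (A : 'M[R]_n) (i j : nat) : R :=
  match insub i, insub j with
  | Some i', Some j' => A i' j'
  | _, _ => 0
  end.

(* M_{j,k}(A) = (-1)^{jk} det(A with rows {1..n-k-1} U {n-k+j..n},
   columns {1..n-j}); with 0-based local index p < n-j, the row is
   p if p < n-k-1, and p+j otherwise (0-based). *)
Definition Mjk (j k : nat) (A : 'M[R]_n) : R :=
  (-1) ^+ (j * k) *
  \det (\matrix_(p < n - j, q < n - j)
          mxget A (if (p < n - k - 1)%N then (p : nat) else (p + j)%N) q).

Definition polyfun (f : {mpoly R[n * n]}) (A : 'M[R]_n) : R :=
  f.@[fun i => mxvec A 0 i].

End Defs.

(* Main.v *)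
(* Conjugating [A] by the diagonal matrix with entries (-1)^i absorbs all signs:
   each factor x_i, i < n, then acts on [A] by a congruence with an elementary
   matrix, and x_n adds a multiple of a wedge of two basis vectors.  The word for
   n + 2 is a block followed by the word for n shifted by 2, so the matrix of size
   n + 2 is the sum of a decomposable bivector t (v ^ u) and of the matrix C of
   size n with parameters from the rest of the word; that is, C is the Schur
   complement of the leading 2 x 2 block.  Undoing on the rows of C the
   congruences by which it was produced makes it antitriangular, and so every
   M_{j,k} with k >= n becomes the product of the same minor of C with one
   coordinate of v or one consecutive 2 x 2 minor of (u, v), computed before these
   congruences are applied, up to a common positive factor.  The parameters of the
   block are ratios of these numbers, whence both directions by induction.

   For minimality, pull the inequalities f_i > 0 back along t |-> A(t).  On the
   curves t_k = eps_k x^(B^k), with x large, the sign of a polynomial is that of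
   one monomial, the same for all choices of signs eps.  As r < N, some nontrivial
   eps makes the signs of these r monomials the same as on the positive orthant,
   so all f_i are positive at a point A(t) where t is not positive. *)
Require Import Defs.
From HB Require Import structures.
From mathcomp Require Import all_boot all_order all_algebra.
From mathcomp Require Import boolp reals.
From mathcomp Require Import mpoly.
From mathcomp Require Import polyrcf.
From mathcomp Require Import zify ring lra.

Set Implicit Arguments.
Unset Strict Implicit.
Unset Printing Implicit Defensive.

Import Order.TTheory GRing.Theory Num.Theory.
Local Open Scope ring_scope.

(** * The action of the generators *)

Section Moves.
Variable R : realFieldType.
Implicit Types (x y z u v : nat -> R) (F C : nat -> nat -> R)
  (p : nat * R) (s : seq (nat * R)).

(* [p = (i, t)] stands for x_i(t), acting on the matrix with 0-based entries
   (-1)^(a+b) A_{ab}: as a congruence for i < n, by an increment for i = n. *)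
Definition vop p x : nat -> R :=
  fun a => x a + (if a.+1 == p.1 then p.2 * x p.1 else 0).

Definition vops s x : nat -> R := foldl (fun y p => vop p y) x s.

Definition mop (n : nat) p F : nat -> nat -> R :=
  if p.1 == n then
    fun a b => F a b + p.2 * ((a.+1 == n) && (b.+2 == n))%:R
                     - p.2 * ((a.+2 == n) && (b.+1 == n))%:R
  else fun a b => vop p (fun b' => vop p (F^~ b') a) b.

Definition mops n s F : nat -> nat -> R := foldl (fun G p => mop n p G) F s.

Definition wedge (t : R) u v : nat -> nat -> R :=
  fun a b => t * (v a * u b - u a * v b).

Definition shiftv x : nat -> R := fun a => if a is a'.+2 then x a' else 0.
Definition shiftm F : nat -> nat -> R :=
  fun a b => if a is a'.+2 then if b is b'.+2 then F a' b' else 0 else 0.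
Definition shifts s := [seq (p.1.+2, p.2) | p <- s].

Definition evec c : nat -> R := fun a => (a == c)%:R.

Lemma funext2 F C : (forall a b, F a b = C a b) -> F = C.
Proof. by move=> H; apply/funext => a; apply/funext => b. Qed.

Lemma vopD p x y : vop p (fun a => x a + y a) = fun a => vop p x a + vop p y a.
Proof. by apply/funext => a; rewrite /vop; case: ifP => _; ring. Qed.

Lemma vopZ p k x : vop p (fun a => k * x a) = fun a => k * vop p x a.
Proof. by apply/funext => a; rewrite /vop; case: ifP => _; ring. Qed.

Lemma vopsD s x y : vops s (fun a => x a + y a) = fun a => vops s x a + vops s y a.
Proof. by elim: s x y => //= p s IH x y; rewrite vopD IH. Qed.

Lemma vopsZ s k x : vops s (fun a => k * x a) = fun a => k * vops s x a.
Proof. by elim: s x => //= p s IH x; rewrite vopZ IH. Qed.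

Lemma vops_cat s1 s2 x : vops (s1 ++ s2) x = vops s2 (vops s1 x).
Proof. by rewrite /vops foldl_cat. Qed.

Lemma mops_cat n s1 s2 F : mops n (s1 ++ s2) F = mops n s2 (mops n s1 F).
Proof. by rewrite /mops foldl_cat. Qed.

Lemma vops_surj s y : exists x, vops s x = y.
Proof.
elim: s y => [|p s IH] y; first by exists y.
have [x' <-] := IH y.
(* The opposite parameter undoes the move, because the move leaves the coordinate [p.1] that it adds
   unchanged. *)
exists (vop (p.1, - p.2) x') => /=; congr vops.
apply/funext => a; rewrite /vop /=.
have -> : (p.1.+1 == p.1) = false by lia.
by case: ifP => _; ring.
Qed.

Lemma vops_fix s x a : (forall p, p \in s -> p.1 != a.+1) -> vops s x a = x a.
Proof.
elim: s x => //= p s IH x H; rewrite IH; last first.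
  by move=> q qs; apply: H; rewrite inE qs orbT.
have := H p; rewrite mem_head => /(_ isT) Hp.
by rewrite /vop eq_sym (negbTE Hp) addr0.
Qed.

(** Only the index [a.+1] can change coordinate [a], and it adds coordinate [a.+1], which stays 0
    because no index reaches [a.+2]. *)
Lemma vops_fix_last s x a :
  (forall p, p \in s -> (p.1 <= a.+1)%N) -> x a.+1 = 0 -> vops s x a = x a.
Proof.
elim: s x => //= p s IH x H xa.
have Hp : (p.1 <= a.+1)%N by apply: H; rewrite mem_head.
rewrite IH; first 1 last.
- by move=> q qs; apply: H; rewrite inE qs orbT.
- by rewrite /vop xa add0r; have -> : (a.+2 == p.1) = false by lia.
by rewrite /vop; case: eqP => [<-|]; rewrite ?xa ?mulr0 addr0.
Qed.

Lemma vops_shift s x : (forall p, p \in s -> (0 < p.1)%N) ->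
  vops (shifts s) (shiftv x) = shiftv (vops s x).
Proof.
elim: s x => //= p s IH x H; rewrite -IH; last first.
  by move=> q qs; apply: H; rewrite inE qs orbT.
congr vops; apply/funext => -[|[|a]]; rewrite /vop /= ?add0r //.
have : (0 < p.1)%N by apply: H; rewrite mem_head.
by case: p.1.
Qed.

Lemma mop_wedge n p t u v G :
  mop n p (fun a b => wedge t u v a b + G a b) =
  if p.1 == n then fun a b => wedge t u v a b + mop n p G a b
  else fun a b => wedge t (vop p u) (vop p v) a b + mop n p G a b.
Proof.
rewrite /mop; case: eqP => _; apply/funext2 => a b; first by ring.
by rewrite /vop /wedge; case: ifP => _; case: ifP => _; ring.
Qed.

(* The moves act affinely: [wedge t u v] is transported by the congruences. *)
Lemma mops_wedge n s t u v G :
  mops n s (fun a b => wedge t u v a b + G a b) =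
  let s' := [seq p <- s | p.1 != n] in
  fun a b => wedge t (vops s' u) (vops s' v) a b + mops n s G a b.
Proof.
elim: s u v G => //= p s IH u v G; rewrite mop_wedge.
by case: ifP => /= _; rewrite IH.
Qed.

Lemma mop_shift n p F : (1 < n)%N -> (0 < p.1)%N ->
  mop n.+2 (p.1.+2, p.2) (shiftm F) = shiftm (mop n p F).
Proof.
move=> n1 p0; rewrite /mop /= !eqSS; case: eqP => [_|_].
  case: n n1 => [|[|m]] // _.
  by apply/funext2 => -[|[|a]] [|[|b]];
    rewrite /= ?eqSS ?andbF ?(mulr0, subr0, addr0).
case: p p0 => -[|i] t //= _.
by apply/funext2 => -[|[|a]] [|[|b]];
  rewrite /vop /= ?eqSS ?(mulr0, addr0, if_same).
Qed.

Lemma mops_shift n s F : (1 < n)%N -> (forall p, p \in s -> (0 < p.1)%N) ->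
  mops n.+2 (shifts s) (shiftm F) = shiftm (mops n s F).
Proof.
move=> n1; elim: s F => //= p s IH F H; rewrite -IH; last first.
  by move=> q qs; apply: H; rewrite inE qs orbT.
by rewrite mop_shift //; apply: H; rewrite mem_head.
Qed.

Lemma mops0 n s : (forall p, p \in s -> p.1 != n) ->
  mops n s (fun _ _ => 0) = fun _ _ => 0.
Proof.
elim: s => //= p s IH H.
have -> : mop n p (fun _ _ => 0) = fun _ _ => 0.
  have /negbTE pn : p.1 != n by apply: H; rewrite mem_head.
  rewrite /mop pn; apply/funext2 => a b.
  by rewrite /vop; do 2!case: ifP => _; ring.
by apply: IH => q qs; apply: H; rewrite inE qs orbT.
Qed.

(** * Decreasing runs and the recursive structure of the word *)

Lemma decrun_rec (b k : nat) : rev (iota b k.+1) = rcons (rev (iota b.+1 k)) b.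
Proof. by rewrite /= rev_cons. Qed.

Lemma mem_decrun a b i : (i \in decrun a b) = (b <= i <= a)%N.
Proof. by rewrite mem_rev mem_iota; lia. Qed.

Lemma size_decrun a b : size (decrun a b) = (a.+1 - b)%N.
Proof. by rewrite size_rev size_iota. Qed.

Lemma uniq_decrun a b : uniq (decrun a b).
Proof. by rewrite rev_uniq iota_uniq. Qed.

Definition run (f : nat -> R) a b := [seq (i, f i) | i <- decrun a b].

(** In a decreasing run coordinate [c.+1] already has its final value when it is added to coordinate
    [c]; hence the output appears on the right. *)
Lemma vops_runE f a b x c :
  vops (run f a b) x c =
  x c + (if (b <= c.+1 <= a)%N then f c.+1 * vops (run f a b) x c.+1 else 0).
Proof.
rewrite /run /decrun; have [k kE] : exists k, k = (a.+1 - b)%N by eexists.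
have -> : (b <= c.+1 <= a)%N = (b <= c.+1 < b + k)%N by lia.
rewrite -kE; move: {kE}a; elim: k b c => [|k IH] b c a.
  by rewrite /=; case: ifP; rewrite ?addr0 //; lia.
rewrite decrun_rec map_rcons -cats1 !vops_cat /= /vop /=.
case: (eqVneq c.+1 b) => [cb|cb].
  have -> : (c.+2 == b) = false by lia.
  have -> : (b <= c.+1 < b + k.+1)%N by lia.
  rewrite addr0 [X in X + _]IH //.
  by case: ifP; rewrite ?cb ?addr0 //; lia.
rewrite addr0 IH //; have -> : (b.+1 <= c.+1 < b.+1 + k)%N = (b <= c.+1 < b + k.+1)%N by lia.
case: ifP => // H; have -> : (c.+2 == b) = false by lia.
by rewrite addr0.
Qed.

(** The recursion determines its solution downwards from the top of the run, so a run is computed by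
    checking a candidate output. *)
Lemma vops_run_eq f a b x y :
  (forall c, y c = x c + (if (b <= c.+1 <= a)%N then f c.+1 * y c.+1 else 0)) ->
  vops (run f a b) x = y.
Proof.
move=> H; apply/funext => c.
have [k] := ubnP (a - c); elim: k c => // k IH c ck.
rewrite vops_runE H; case: ifP => // Hc; rewrite IH //; lia.
Qed.

Lemma decrunSS a b : [seq i.+2 | i <- decrun a b] = decrun a.+2 b.+2.
Proof.
by rewrite /decrun map_rev; congr rev; rewrite subSS (iotaDl 2).
Qed.

Lemma wordSS n : word n.+2 =
  n.+2 :: decrun n 1 ++ decrun n.+1 2 ++ [seq i.+2 | i <- word n].
Proof.
rewrite /word /= -catA subn2 /= map_flatten -map_comp (iotaDl 1) -map_comp.
congr (_ :: _ ++ (_ ++ flatten _)); apply/eq_in_map => m; rewrite mem_iota => Hm /=.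
(* An index [m] exists only for n >= 2, and this makes the truncated subtractions exact. *)
have n2 : (1 < n)%N by have := odd_double_half n; lia.
rewrite map_cat !decrunSS /=; congr (_ :: decrun _ _ ++ decrun _ _); lia.
Qed.

Lemma mem_word n i : i \in word n -> (0 < i <= n)%N.
Proof.
have [k] := ubnP n; elim: k n i => // k IH [|[|n]] // i nk.
rewrite wordSS inE !mem_cat !mem_decrun => /or4P[/eqP->|||/mapP[j]]; try lia.
by move=> /IH -/(_ ltac:(lia)) Hj ->; lia.
Qed.

Lemma size_word n : size (word n) = 'C(n, 2).
Proof.
have [k] := ubnP n; elim: k n => // k IH [|[|n]] // nk.
rewrite wordSS /= !size_cat !size_decrun size_map IH; last by lia.
rewrite !binS bin1 bin0 subSS subn0 subn2 /=; lia.
Qed.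

(** Up to the signs (-1)^(a+b) this is A(t), by [Amat_TPseq]. A list of parameters, unlike a
    function on ordinals, is easily split into blocks. *)
Definition TPseq n (l : seq R) : nat -> nat -> R :=
  mops n (zip (word n) l) (fun _ _ => 0).

Definition congs (n : nat) (l : seq R) := [seq p <- zip (word n) l | p.1 != n].

Lemma congs_range n l p : p \in congs n l -> (0 < p.1 < n)%N.
Proof.
rewrite mem_filter => /andP[/= pn pz].
have /mem_word : p.1 \in word n; last by lia.
move: pz; elim: (word n) l => [|i w IH] [|t l] //=.
by rewrite !inE => /predU1P[->|/IH ->]; rewrite ?eqxx ?orbT.
Qed.

Definition block_vec n (f g : nat -> R) x := vops (run g n.+1 2) (vops (run f n 1) x).

Definition block_seq n (t : R) (f g : nat -> R) :=
  t :: map f (decrun n 1) ++ map g (decrun n.+1 2).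

Lemma zip_run f a b : zip (decrun a b) (map f (decrun a b)) = run f a b.
Proof. by rewrite /run; elim: (decrun a b) => //= i s ->. Qed.

Lemma zip_blockE n t f g l :
  zip (word n.+2) (block_seq n t f g ++ l) =
  (n.+2, t) :: (run f n 1 ++ run g n.+1 2) ++ shifts (zip (word n) l).
Proof.
rewrite wordSS /= -!catA !zip_cat ?size_map // !zip_run; congr (_ :: _ ++ (_ ++ _)).
by elim: (word n) l => [|i w IH] [|t' l] //=; rewrite IH.
Qed.

Lemma run_neq f a b m p : (a < m)%N -> p \in run f a b -> p.1 != m.
Proof. by move=> am /mapP[i]; rewrite mem_decrun => Hi -> /=; lia. Qed.

Lemma filter_all_id (T : eqType) (P : pred T) (s : seq T) :
  (forall e, e \in s -> P e) -> filter P s = s.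
Proof. by move=> H; apply/all_filterP/allP. Qed.

Lemma congs_block n t f g l :
  congs n.+2 (block_seq n t f g ++ l) =
  (run f n 1 ++ run g n.+1 2) ++ shifts (congs n l).
Proof.
rewrite /congs zip_blockE /= eqxx /= filter_cat; congr (_ ++ _).
  apply: filter_all_id => p; rewrite mem_cat => /orP[] /run_neq; apply; lia.
by rewrite /shifts filter_map; congr map; apply: eq_filter => -[i x] /=.
Qed.

(** The first letter creates t times a wedge of two basis vectors, and all later congruences
    transport it. The moves being affine, the rest of the word separately builds the shifted smaller
    matrix from 0. *)
Lemma TPseq_rec n t f g l :
  let up x := vops (shifts (congs n l)) (block_vec n f g x) in
  TPseq n.+2 (block_seq n t f g ++ l) =
  fun a b => wedge t (up (evec n)) (up (evec n.+1)) a b + shiftm (TPseq n l) a b.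
Proof.
move=> up; rewrite /TPseq zip_blockE /=.
have -> : mop n.+2 (n.+2, t) (fun _ _ => 0) =
          fun a b => wedge t (evec n) (evec n.+1) a b + (fun _ _ => 0) a b.
  apply/funext2 => a b; rewrite /mop /= eqxx /wedge /evec !eqSS.
  by rewrite -!mulnb !natrM; ring.
have := congs_block n t f g l; rewrite {1}/congs zip_blockE /= eqxx /= => E.
rewrite mops_wedge E; apply/funext2 => a b; congr (_ + _).
  by rewrite !vops_cat.
rewrite mops_cat mops0; last first.
  move=> p; rewrite mem_cat => /orP[] /run_neq; apply; lia.
have E0 : shiftm (fun _ _ : nat => 0 : R) = fun _ _ => 0.
  by apply/funext2 => -[|[|?]] [|[|?]].
(* For n <= 1 the remaining word is empty, and [mops_shift] does not apply. *)
have [n1|n1] := leqP n 1.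
  by case: n n1 {up E} => [|[|//]] _; case: l => [|? ?]; rewrite /word /= E0.
rewrite -{1}E0 mops_shift // => p pz.
have /mem_word : p.1 \in word n; last by lia.
move: pz; elim: (word n) l {up E} => [|i w IH] [|t' l] //=.
by rewrite !inE => /predU1P[->|/IH ->]; rewrite ?eqxx ?orbT.
Qed.

End Moves.

(** * Minors *)

Section Minors.
Variable R : realFieldType.
Implicit Types (x y z u v : nat -> R) (F C Y : nat -> nat -> R)
  (s : seq (nat * R)) (r : nat -> nat).

Definition minor c r F : R := \det (\matrix_(p < c, q < c) F (r p) q).

Lemma eq_minor c r1 r2 F1 F2 :
  (forall p q, (p < c)%N -> (q < c)%N -> F1 (r1 p) q = F2 (r2 p) q) ->
  minor c r1 F1 = minor c r2 F2.
Proof. by move=> H; congr (\det _); apply/matrixP => p q; rewrite !mxE H. Qed.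

Lemma minor0 r F : minor 0 r F = 1.
Proof. exact: det_mx00. Qed.

Lemma det_mx22 (M : 'M[R]_2) : \det M = M 0 0 * M 1 1 - M 0 1 * M 1 0.
Proof.
rewrite (expand_det_row _ 0) !big_ord_recl big_ord0 addr0 /cofactor !det_mx11 !mxE.
have -> : lift 0 0 = 1 :> 'I_2 by apply/val_inj.
have -> : lift (1 : 'I_2) 0 = 0 :> 'I_2 by apply/val_inj.
by rewrite /= expr0 expr1; ring.
Qed.

Lemma minor_row1 c r Y : (forall b, (b < c)%N -> Y (r 0%N) b.+1 = 0) ->
  minor c.+1 r Y = Y (r 0%N) 0%N * minor c (fun p => r p.+1) (fun a b => Y a b.+1).
Proof.
move=> H; rewrite /minor -[c.+1]/(1 + c)%N -[X in \det X]submxK.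
have -> : ursubmx (\matrix_(p < 1 + c, q < 1 + c) Y (r p) q) = 0.
  by apply/matrixP => i j; rewrite !mxE /= ord1 add1n H.
rewrite det_lblock det_mx11 !mxE /=; congr (_ * \det _).
by apply/matrixP => i j; rewrite !mxE /= !add1n.
Qed.

Lemma minor_row2 c r Y :
  (forall p b, (p < 2)%N -> (b < c)%N -> Y (r p) b.+2 = 0) ->
  minor c.+2 r Y =
  (Y (r 0%N) 0%N * Y (r 1%N) 1%N - Y (r 0%N) 1%N * Y (r 1%N) 0%N) *
  minor c (fun p => r p.+2) (fun a b => Y a b.+2).
Proof.
move=> H; rewrite /minor -[c.+2]/(2 + c)%N -[X in \det X]submxK.
have -> : ursubmx (\matrix_(p < 2 + c, q < 2 + c) Y (r p) q) = 0.
  by apply/matrixP => i j; rewrite !mxE /= add2n H.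
rewrite det_lblock det_mx22 !mxE /=; congr (_ * \det _).
by apply/matrixP => i j; rewrite !mxE /= !add2n.
Qed.

(** The columns of [wedge t u v] are combinations of [u] and [v]; these two vectors replace the
    first two columns when a minor on initial columns is computed. *)
Definition frame u v C : nat -> nat -> R := fun a b =>
  match b with 0%N => u a | 1%N => v a | _ => shiftm C a b end.

(** The matrix is [frame u v C] times a block upper triangular [T] whose first two rows expand the
    wedge along [u] and [v]. As [v] vanishes at 0, a single product is left in the determinant of
    [T]. *)
Lemma minor_wedge c r t u v C : v 0%N = 0 ->
  minor c.+2 r (fun a b => wedge t u v a b + shiftm C a b) =
  t ^+ 2 * u 0%N * v 1%N * minor c.+2 r (frame u v C).
Proof.
move=> v0.
pose T : 'M[R]_(2 + c) := \matrix_(q, b)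
  match nat_of_ord q with 0%N => - t * v b | 1%N => t * u b
  | _ => (q == b :> nat)%:R end.
have detT : \det T = t ^+ 2 * u 0%N * v 1%N.
  rewrite -[T]submxK.
  have -> : dlsubmx T = 0.
    by apply/matrixP => i j; rewrite !mxE /=; case: (ltngtP i.+2 j) => //; case: j => /= *; lia.
  have -> : drsubmx T = 1%:M.
    by apply/matrixP => i j; rewrite !mxE /= !add2n !eqSS.
  by rewrite det_ublock det1 mulr1 det_mx22 !mxE /= v0; ring.
rewrite mulrC -detT /minor -det_mulmx; congr (\det _).
apply/matrixP => p b; rewrite !mxE !big_ord_recl !mxE /=.
have -> : \sum_(i < c) (\matrix_(p, q) frame u v C (r p) q) p (lift ord0 (lift ord0 i)) *
       T (lift ord0 (lift ord0 i)) b = shiftm C (r p) b.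
  case: b => -[|[|b]] Hb /=.
  - rewrite big1 => [|i _]; first by case: (r p) => [|[]].
    by rewrite !mxE /= mulr0.
  - rewrite big1 => [|i _]; first by case: (r p) => [|[]].
    by rewrite !mxE /= mulr0.
  pose b' : 'I_c := Ordinal (Hb : (b < c)%N).
  rewrite (bigD1 b') //= !mxE /= eqxx mulr1 big1 ?addr0 //.
  by move=> i ib; rewrite !mxE /= !eqSS (negbTE (ib : (i : nat) != b)) mulr0.
rewrite addrA; congr (_ + _); rewrite /wedge; ring.
Qed.

(** The selected rows are consecutive and no index exceeds the last of them. A move thus adds to a
    selected row the next one, also selected, or it changes an unselected row; it acts on the minor
    by a unitriangular factor. *)
Lemma minor_vops c m s Y : (forall p : nat * R, p \in s -> (p.1 < m + c)%N) ->
  minor c (addn m) (fun a b => vops s (Y^~ b) a) = minor c (addn m) Y.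
Proof.
elim: s Y => [|[i t] s IH] Y H //=.
rewrite (IH (fun a b => vop (i, t) (Y^~ b) a)); last first.
  by move=> q qs; apply: H; rewrite inE qs orbT.
have ic : (i < m + c)%N by apply: (H (i, t)); rewrite mem_head.
pose T : 'M[R]_c := \matrix_(p, q) ((p == q)%:R +
  t * (((m + p).+1 == i) && (m + q == i)%N)%:R).
have detT : \det T = 1.
  rewrite -det_tr det_trig; last first.
    apply/is_trig_mxP => p q pq; rewrite !mxE.
    have -> : (q == p) = false by apply/negbTE; rewrite -val_eqE /=; lia.
    have -> : ((m + q).+1 == i) && (m + p == i)%N = false by lia.
    by rewrite mulr0 addr0.
  rewrite big1 // => p _; rewrite !mxE eqxx.
  have -> : ((m + p).+1 == i) && (m + p == i)%N = false by lia.
  by rewrite mulr0 addr0.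
rewrite -[RHS]mul1r -detT /minor -det_mulmx; congr (\det _).
apply/matrixP => p b; rewrite !mxE /vop /=.
under eq_bigr do rewrite !mxE mulrDl.
rewrite big_split /= (bigD1 p) //= eqxx mul1r big1 ?addr0; last first.
  by move=> q qp; rewrite eq_sym (negbTE qp) mul0r.
congr (_ + _); case: eqP => [pi|_] /=; last first.
  by rewrite big1 // => q _; rewrite mulr0 mul0r.
have pc : (p.+1 < c)%N by lia.
pose p' := Ordinal pc; rewrite (bigD1 p') //= addnS pi eqxx mulr1 big1 ?addr0 //.
move=> q qp; have -> : (m + q == i)%N = false; last by rewrite mulr0 mul0r.
apply/negbTE; apply: contraNneq qp => qi; rewrite -val_eqE /=; lia.
Qed.

End Minors.

(** * From size n to size n + 2 *)

Section Recursion.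
Variable R : realFieldType.
Implicit Types (x y z u v : nat -> R) (f g : nat -> R) (F C Y : nat -> nat -> R)
  (s : seq (nat * R)) (l : seq R).

Lemma map_of_seq (r : seq nat) l : uniq r -> size l = size r ->
  exists f, l = map f r.
Proof.
move=> ur szl; exists (fun i => nth 0 l (index i r)).
apply: (@eq_from_nth _ 0) => [|i il]; first by rewrite size_map.
by rewrite (nth_map 0%N) -?szl // index_uniq // -szl.
Qed.

Lemma block_seqP n l : size l = 'C(n.+2, 2) ->
  exists t f g l2, l = block_seq n t f g ++ l2 /\ size l2 = 'C(n, 2).
Proof.
rewrite -size_word wordSS /= !size_cat !size_decrun size_map size_word.
case: l => //= t l [szl].
have [f Ef] : exists f, take (n.+1 - 1) l = map f (decrun n 1).
  by apply: map_of_seq; rewrite ?uniq_decrun // size_decrun size_takel // szl leq_addr.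
have [g Eg] : exists g, take (n.+2 - 2) (drop (n.+1 - 1) l) = map g (decrun n.+1 2).
  apply: map_of_seq; rewrite ?uniq_decrun // size_decrun size_takel //.
  by rewrite size_drop szl addKn leq_addr.
exists t, f, g, (drop (n.+2 - 2) (drop (n.+1 - 1) l)); split.
  by rewrite /block_seq -Ef -Eg /= -catA !cat_take_drop.
by rewrite !size_drop szl !addKn.
Qed.

(** The recursions of the two runs, solved for their inputs in reverse order. *)
Definition block_inv n f g y : nat -> R :=
  let z c := y c - (if (2 <= c.+1 <= n.+1)%N then g c.+1 * y c.+1 else 0) in
  fun c => z c - (if (1 <= c.+1 <= n)%N then f c.+1 * z c.+1 else 0).

Lemma block_invK n f g y : block_vec n f g (block_inv n f g y) = y.
Proof.
set z := fun c => y c - (if (2 <= c.+1 <= n.+1)%N then g c.+1 * y c.+1 else 0).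
rewrite /block_vec (vops_run_eq (f := f) (y := z)); last by move=> c; rewrite subrK.
by apply: vops_run_eq => c; rewrite /z subrK.
Qed.

Definition omega u v c : R := u c * v c.+1 - v c * u c.+1.

(** The normalization that a block gives to the images of two basis vectors, and under which [t],
    [u] and [v] can be read off a matrix. *)
Definition normalized n u v :=
  [/\ v 0%N = 0, v n.+1 = 1, u n.+1 = 0 & u n = 1].

Section Block.
Variables (n : nat) (f g : nat -> R).
Let x1 := vops (run f n 1) (evec R n).
Let u0 := block_vec n f g (evec R n).
Let v0 := block_vec n f g (evec R n.+1).

Lemma block_x1 : [/\ x1 n = 1, forall c, (n < c)%N -> x1 c = 0 &
  forall c, (c < n)%N -> x1 c = f c.+1 * x1 c.+1].
Proof.
have E := @vops_runE _ f n 1 (evec R n); split=> [|c nc|c cn]; rewrite /x1 E /evec.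
- by rewrite eqxx ltnn addr0.
- by rewrite (gtn_eqF nc) ifF ?addr0 //; lia.
- by rewrite (ltn_eqF cn) ifT ?add0r //; lia.
Qed.

Lemma block_v0 : [/\ v0 0%N = 0, v0 n.+1 = 1, forall c, (n.+1 < c)%N -> v0 c = 0 &
  forall c, (1 <= c <= n)%N -> v0 c = g c.+1 * v0 c.+1].
Proof.
have E0 : v0 = vops (run g n.+1 2) (evec R n.+1).
  rewrite /v0 /block_vec (vops_run_eq (f := f) (y := evec R n.+1)) // => c.
  by case: ifP; rewrite ?addr0 // /evec => H; rewrite (ltn_eqF (_ : c.+1 < _)%N) ?mulr0 ?addr0 //; lia.
have E := @vops_runE _ g n.+1 2 (evec R n.+1).
split=> [|//|c nc|c cn]; rewrite E0 E /evec /=.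
- by rewrite add0r.
- by rewrite eqxx ifF ?addr0 //; lia.
- by rewrite (gtn_eqF nc) ifF ?addr0 //; lia.
- by rewrite (ltn_eqF (_ : c < _)%N) ?ifT ?add0r //; lia.
Qed.

(** In [omega] the contributions of the second run cancel, since [u0] and [v0] get the same factor
    from it; only the source term [x1] survives. At c = 0 this run does nothing, but [v0] vanishes
    there. *)
Lemma block_u0 : [/\ u0 n = 1, forall c, (n < c)%N -> u0 c = 0 &
  forall c, (c <= n)%N -> omega u0 v0 c = x1 c * v0 c.+1].
Proof.
have [x1n x1S x1c] := block_x1; have [v00 _ _ v0c] := block_v0.
have E c : u0 c = x1 c + (if (2 <= c.+1 <= n.+1)%N then g c.+1 * u0 c.+1 else 0).
  by rewrite /u0 /block_vec vops_runE.
have u0S c : (n < c)%N -> u0 c = 0 by move=> nc; rewrite E x1S // ifF ?addr0 //; lia.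
split=> // [|c cn]; first by rewrite E x1n u0S // mulr0 if_same addr0.
rewrite /omega E; case: ifP => [H|H]; first by rewrite (v0c c) //; ring.
have -> : c = 0%N by lia.
by rewrite v00; ring.
Qed.

Lemma block_normalized : normalized n u0 v0.
Proof. by have [? ? _] := block_u0; have [? ? _ _] := block_v0; split; auto. Qed.

End Block.

Lemma shifts_congs_range (n : nat) l (p : nat * R) : p \in shifts (congs n l) -> (2 < p.1 < n.+2)%N.
Proof.
move=> /mapP[q /congs_range H ->] /=.
by lia.
Qed.

Lemma vops_shifts_low n l x a : (a < 2)%N -> vops (shifts (congs n l)) x a = x a.
Proof. by move=> a2; rewrite vops_fix // => p /shifts_congs_range; lia. Qed.

Lemma shiftmSS C b : (shiftm C)^~ b.+2 = shiftv (C^~ b).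
Proof. by apply/funext => -[|[|]]. Qed.

Lemma shiftm_low C b : (b < 2)%N -> (shiftm C)^~ b = fun _ => 0.
Proof. by case: b => [|[|//]] _; apply/funext => -[|[|]]. Qed.

Lemma vops0 s : vops s (fun _ => 0) = fun _ => 0.
Proof.
elim: s => //= p s IH; rewrite -{2}IH; congr vops.
by apply/funext => a; rewrite /vop mulr0 if_same addr0.
Qed.

(* Undoing the congruences on the rows only, a totally positive matrix becomes
   triangular with respect to the antidiagonal. *)
Lemma TPseq_antitriangular n l : size l = 'C(n, 2) ->
  exists2 Q : nat -> nat -> R,
    forall b, vops (congs n l) (Q^~ b) = (TPseq n l)^~ b &
    forall a b, ((a + b).+1 < n)%N -> Q a b = 0.
Proof.
have [k] := ubnP n; elim: k n l => // k IH [|[|n]] l nk szl.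
- by case: l szl => // _; exists (fun _ _ => 0).
- by case: l szl => // _; exists (fun _ _ => 0).
have [t [f [g [l2 [-> /(IH n) [|Q QE Q0]]]]]] := block_seqP szl; first by lia.
rewrite TPseq_rec congs_block; set S := shifts _.
set u := vops S (block_vec n f g (evec R n)).
set v := vops S (block_vec n f g (evec R n.+1)).
(* Column [b] of the wedge is t u_b v - t v_b u, where [v] and [u] are the images of basis vectors n
   + 1 and n. The last term carries the smaller [Q] back through the block. *)
exists (fun a b => (t * u b * evec R n.+1 a + (- (t * v b)) * evec R n a) +
  block_inv n f g ((shiftm Q)^~ b) a) => [b|a b ab].
  move: (block_inv _ _ _ _) (block_invK n f g ((shiftm Q)^~ b)) => z zE.
  rewrite vops_cat -/S !vopsD !vopsZ !vops_cat.
  rewrite -[vops (run g _ _) (vops _ z)]/(block_vec n f g z) zE.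
  rewrite -/(block_vec n f g (evec R n)) -/(block_vec n f g (evec R n.+1)) -/u -/v.
  apply/funext => a; rewrite /wedge; congr (_ + _); first by ring.
  clear zE; case: b => [|[|b]]; rewrite ?shiftmSS; last first.
  - rewrite vops_shift; last by move=> p /congs_range; lia.
    by rewrite QE; case: a => [|[|]].
  - by rewrite !shiftm_low // vops0; case: a => [|[|]].
  - by rewrite !shiftm_low // vops0; case: a => [|[|]].
(* The bound leaves room for [block_inv], which involves the rows [a], [a.+1] and [a.+2]. *)
have Z c d : (c + d <= n.+2)%N -> shiftm Q c d = 0.
  by case: c => [|[|c]] //; case: d => [|[|d]] //= H; apply: Q0; lia.
rewrite /block_inv !Z ?(mulr0, if_same, subr0, addr0) //; try by lia.
rewrite /evec (ltn_eqF (_ : a < _)%N) ?mulr0 ?add0r //; last by lia.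
case: eqP => [an|]; last by rewrite mulr0.
have -> : b = 0%N by lia.
by rewrite /v vops_shifts_low //; have [-> _ _ _] := block_normalized n f g; ring.
Qed.

(** The test minor without its sign, which the conjugation by signs absorbs; see [Mjk_coefs]. *)
Definition Mf n j k F : R :=
  minor (n - j) (fun p => if (p < n - k - 1)%N then p else (p + j)%N) F.

Lemma Mf_corner n j F : (0 < n)%N -> Mf n j (n - 1) F = minor (n - j) (addn j) F.
Proof.
move=> n0; apply: eq_minor => p q _ _; rewrite ifF; first by rewrite addnC.
by lia.
Qed.

(** For k < n the rows 0 and 1 are both selected, and in [frame u v C] they vanish outside the first
    two columns. *)
Lemma Mf_Schur n j k t u v C : v 0%N = 0 -> (1 <= j <= k)%N -> (k < n)%N ->
  Mf n.+2 j k (fun a b => wedge t u v a b + shiftm C a b) =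
  (t * u 0%N * v 1%N) ^+ 2 * Mf n j k C.
Proof.
move=> v0 jk kn; rewrite /Mf; have -> : (n.+2 - j = (n - j).+2)%N by lia.
rewrite minor_wedge // minor_row2 => [|p b p2 _]; last first.
  by rewrite ifT; [case: p p2 => [|[|]] | lia].
rewrite !ifT /=; [|lia|lia].
rewrite v0 mul0r subr0.
rewrite (@eq_minor _ _ _ (fun p => if (p < n - k - 1)%N then p else (p + j)%N) _ C).
  by ring.
move=> p q _ _; have -> : (p.+2 < n.+2 - k - 1)%N = (p < n - k - 1)%N by lia.
by case: ifP => _ /=; rewrite ?addSn.
Qed.

(** For k = n + 1 the rows form a final segment, for k = n a final segment preceded by row 0. On a
    final segment [minor_vops] undoes the congruences, turning [u], [v], [C] into [u0], [v0] and the
    antitriangular [Q]. Coordinates 0 and 1 are never moved. *)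
Lemma Mf_rec n l t u0 v0 : size l = 'C(n, 2) -> normalized n u0 v0 ->
  let S := shifts (congs n l) in
  let C := TPseq n l in
  let F a b := wedge t (vops S u0) (vops S v0) a b + shiftm C a b in
  [/\ forall j k, (1 <= j <= k)%N -> (k < n)%N ->
        Mf n.+2 j k F = (t * u0 0%N * v0 1%N) ^+ 2 * Mf n j k C,
      forall j, (1 <= j <= n)%N -> Mf n.+2 j n F =
        t ^+ 2 * u0 0%N * v0 1%N * (u0 0%N * (v0 j.+1 * minor (n - j) (addn j) C)),
      forall j, (1 <= j <= n)%N -> Mf n.+2 j n.+1 F =
        t ^+ 2 * u0 0%N * v0 1%N * (omega u0 v0 j * minor (n - j) (addn j) C) &
      Mf n.+2 n.+1 n.+1 F = t * u0 0%N].
Proof.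
move=> szl [v00 v0n u0n u0n1] S C F; set u := vops S u0; set v := vops S v0.
have [Q QE Q0] := TPseq_antitriangular szl.
have uE a : (a < 2)%N -> u a = u0 a by exact: vops_shifts_low.
have vE a : (a < 2)%N -> v a = v0 a by exact: vops_shifts_low.
have W c r : minor c.+2 r F = t ^+ 2 * u0 0%N * v0 1%N * minor c.+2 r (frame u v C).
  by rewrite minor_wedge -/u -/v ?uE ?vE.
have frameE : frame u v C = fun a b => vops S ((frame u0 v0 Q)^~ b) a.
  apply/funext2 => a [|[|b]] //.
  rewrite -[(frame _ _ Q)^~ _]/((shiftm Q)^~ b.+2) shiftmSS vops_shift ?QE.
    by case: a => [|[|]].
  by move=> p /congs_range; lia.
have corner j : (j <= n)%N -> minor (n - j) (addn j) C = minor (n - j) (addn j) Q.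
  move=> jn; rewrite -(@minor_vops _ (n - j) j (congs n l) Q); last first.
    by move=> p /congs_range; lia.
  by apply: eq_minor => p q _ _; rewrite QE.
have subS j : (j <= n)%N -> (n.+2 - j = (n - j).+2)%N by lia.
split.
- by move=> j k jk kn; rewrite Mf_Schur -/u -/v ?uE ?vE.
- move=> j jn; rewrite /Mf subS ?W; last by lia.
  have -> : (n.+2 - n - 1 = 1)%N by lia.
  rewrite minor_row1 => [|[|b] _ //=]; last by rewrite vE.
  rewrite -[frame _ _ _ _ 0%N]/(u 0%N) uE //; congr (_ * (_ * _)).
  rewrite (@eq_minor _ _ _ (addn j.+1) _ (fun a b => vops S ((fun a b => frame u0 v0 Q a b.+1)^~ b) a)); last first.
    by move=> p q _ _; rewrite frameE; congr vops; lia.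
  rewrite minor_vops => [|p /shifts_congs_range]; last by lia.
  (* Row j + 1 of the frame contains row j - 1 of [Q], whose first n - j entries vanish. *)
  rewrite minor_row1 => [|b bc]; last first.
    by case: j jn bc => [|j] jn bc /=; rewrite ?addn0 //=; apply: Q0; lia.
  rewrite addn0 corner; last by lia.
  by congr (_ * _); apply: eq_minor => p q _ _; rewrite addSnnS /= !addnS.
- move=> j jn; rewrite /Mf subS ?W; last by lia.
  have -> : (n.+2 - n.+1 - 1 = 0)%N by lia.
  congr (_ * _).
  rewrite (@eq_minor _ _ _ (addn j) _ (fun a b => vops S ((frame u0 v0 Q)^~ b) a)); last first.
    by move=> p q _ _; rewrite frameE; congr vops; lia.
  rewrite minor_vops => [|p /shifts_congs_range]; last by lia.
  rewrite minor_row2 => [|p b p2 bc]; last first.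
    by rewrite /=; case E: (j + p)%N => [|[|a]] //=; apply: Q0; lia.
  rewrite addn0 addn1 /= corner; last by lia.
  by congr (_ * _); apply: eq_minor => p q _ _; rewrite !addnS.
- rewrite /Mf; have -> : (n.+2 - n.+1 = 1)%N by lia.
  rewrite minor_row1 // minor0 mulr1 /= /F /wedge -/u -/v add0n (uE 0%N) // (vE 0%N) // v00.
  have -> : v n.+1 = 1.
    by rewrite /v vops_fix // => p /shifts_congs_range; lia.
  by case: n.+1 => [|[|?]] /=; ring.
Qed.

End Recursion.

(** * Positivity of the test minors *)

Section Positivity.
Variable R : realFieldType.
Implicit Types (u v : nat -> R) (f g : nat -> R) (F C : nat -> nat -> R) (l : seq R).

Definition Mpos n F := forall j k, (1 <= j <= k)%N -> (k < n)%N -> 0 < Mf n j k F.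

Lemma Mpos_rec n l t u0 v0 : size l = 'C(n, 2) -> normalized n u0 v0 ->
  let S := shifts (congs n l) in
  let C := TPseq n l in
  let F a b := wedge t (vops S u0) (vops S v0) a b + shiftm C a b in
  Mpos n.+2 F <->
  [/\ Mpos n C, 0 < t, forall c, (1 <= c <= n.+1)%N -> 0 < v0 c &
      forall c, (c <= n)%N -> 0 < omega u0 v0 c].
Proof.
move=> szl nuv S C F; have [M1 M2 M3 M4] := Mf_rec t szl nuv.
have [v00 v0n u0n u0n1] := nuv; rewrite -/S -/C -/F in M1 M2 M3 M4.
have w0 : omega u0 v0 0 = u0 0%N * v0 1%N by rewrite /omega v00; ring.
have wn : omega u0 v0 n = 1 by rewrite /omega v0n u0n1 u0n; ring.
have corner j : Mpos n C -> (1 <= j <= n)%N -> 0 < minor (n - j) (addn j) C.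
  move=> MC jn; have [->|jn'] := eqVneq j n; first by rewrite subnn minor0.
  by rewrite -Mf_corner; [apply: MC; lia | lia].
split=> [MF|[MC t0 v0_gt0 w_gt0]]; last first.
  have v1 : 0 < v0 1%N by apply: v0_gt0.
  have u1 : 0 < u0 0%N by have := w_gt0 0%N isT; rewrite w0 pmulr_lgt0.
  have K0 : 0 < t ^+ 2 * u0 0%N * v0 1%N by rewrite !mulr_gt0 ?exprn_gt0.
  move=> j k jk; rewrite ltnS leq_eqVlt ltnS leq_eqVlt => /or3P[/eqP kn|/eqP kn|kn].
  - have [jn|jn] := eqVneq j n.+1; first by rewrite kn jn M4 mulr_gt0.
    by rewrite kn M3 ?mulr_gt0 ?corner ?w_gt0 //; lia.
  - by rewrite kn M2 ?mulr_gt0 ?corner ?v0_gt0 //; lia.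
  - by rewrite M1 // mulr_gt0 ?exprn_gt0 ?mulr_gt0 ?MC.
(* For n > 0, the pair (j, k) = (n, n + 1) gives the sign of the common factor, then (n, n) that of
   [u0 0] and (n + 1, n + 1) that of [t]. For n = 0 the normalization makes [u0 0] and [v0 1] equal
   to 1. *)
have [t0 u1 v1] : [/\ 0 < t, 0 < u0 0%N & 0 < v0 1%N].
  have : 0 < Mf n.+2 n.+1 n.+1 F by apply: MF; lia.
  rewrite M4; have [n0|n0] := posnP n.
    by move: v0n u0n1; rewrite n0 => -> ->; rewrite mulr1.
  have := MF n n.+1; rewrite M3 ?wn ?subnn ?minor0 ?mulr1; last by lia.
  move=> /(_ ltac:(lia) ltac:(lia)) K0.
  have := MF n n; rewrite M2 ?v0n ?subnn ?minor0 ?mulr1 ?(pmulr_rgt0 _ K0) //; last by lia.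
  move=> /(_ ltac:(lia) ltac:(lia)) u1; rewrite pmulr_lgt0 // => t0.
  by split=> //; move: K0; rewrite pmulr_rgt0 // mulr_gt0 ?exprn_gt0.
have K0 : 0 < t ^+ 2 * u0 0%N * v0 1%N by rewrite !mulr_gt0 ?exprn_gt0.
have MC : Mpos n C.
  move=> j k jk kn; have := MF j k jk; rewrite M1 // pmulr_rgt0; first by apply; lia.
  by rewrite exprn_gt0 ?mulr_gt0.
split=> // c cn.
- have [->//|c1] := eqVneq c 1%N.
  have := MF c.-1 n; rewrite M2 ?(pmulr_rgt0 _ K0) ?(pmulr_rgt0 _ u1) //; last by lia.
  rewrite pmulr_lgt0; last by apply: corner => //; lia.
  by rewrite prednK; [apply; lia | lia].
- have [->|c0] := posnP c; first by rewrite w0 mulr_gt0.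
  have := MF c n.+1; rewrite M3 ?(pmulr_rgt0 _ K0) //; last by lia.
  rewrite pmulr_lgt0; last by apply: corner => //; lia.
  by apply; lia.
Qed.

(** The parameters [f] and [g] are the ratios of consecutive entries of [x1] and [v0], both ending
    in 1, and [omega] is a product of such entries. *)
Lemma block_pos n t f g :
  let u0 := block_vec n f g (evec R n) in
  let v0 := block_vec n f g (evec R n.+1) in
  [/\ 0 < t, forall c, (1 <= c <= n.+1)%N -> 0 < v0 c &
      forall c, (c <= n)%N -> 0 < omega u0 v0 c] <->
  all (>%R^~ 0) (block_seq n t f g).
Proof.
move=> u0 v0.
have [x1n _ x1c] := block_x1 n f; have [v00 v0n _ v0c] := block_v0 n f g.
have [_ _ wE] := block_u0 n f g; rewrite -/u0 -/v0 in v00 v0n v0c wE.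
set x1 := vops _ _ in x1n x1c wE.
rewrite /= all_cat; split=> [[-> v0_gt0 w_gt0]|/and3P[-> /allP f_gt0 /allP g_gt0]] /=.
  have x1_gt0 c : (c <= n)%N -> 0 < x1 c.
    by move=> cn; have := w_gt0 c cn; rewrite wE // pmulr_lgt0 ?v0_gt0.
  apply/andP; split; apply/allP => y /mapP[[|c]]; rewrite mem_decrun => cn -> //.
    have := x1_gt0 c; rewrite x1c; last by lia.
    by rewrite pmulr_lgt0; [apply; lia | apply: x1_gt0; lia].
  have := v0_gt0 c; rewrite v0c; last by lia.
  by rewrite pmulr_lgt0; [apply; lia | apply: v0_gt0; lia].
have {}f_gt0 c : (c < n)%N -> 0 < f c.+1.
  by move=> cn; apply/f_gt0/map_f; rewrite mem_decrun; lia.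
have {}g_gt0 c : (1 <= c <= n)%N -> 0 < g c.+1.
  by move=> cn; apply/g_gt0/map_f; rewrite mem_decrun; lia.
have v0_gt0 c : (1 <= c <= n.+1)%N -> 0 < v0 c.
  move=> cn; have [k] := ubnP (n.+1 - c); elim: k c cn => // k IH c cn ck.
  have [->|c'] := eqVneq c n.+1; first by rewrite v0n.
  rewrite v0c ?mulr_gt0 ?g_gt0 ?IH //; lia.
split=> // c cn; rewrite wE // mulr_gt0 ?v0_gt0 //.
have [k] := ubnP (n - c); elim: k c cn => // k IH c cn ck.
have [->|c'] := eqVneq c n; first by rewrite x1n.
rewrite x1c ?mulr_gt0 ?f_gt0 ?IH //; lia.
Qed.

Lemma Mpos_TPseq n l : size l = 'C(n, 2) ->
  Mpos n (TPseq n l) <-> all (>%R^~ 0) l.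
Proof.
have [k] := ubnP n; elim: k n l => // k IH [|[|n]] l nk szl.
- by case: l szl => // _; split=> // _ j k'; lia.
- by case: l szl => // _; split=> // _ j k'; lia.
have [t [f [g [l2 [-> szl2]]]]] := block_seqP szl.
rewrite TPseq_rec Mpos_rec //; last exact: block_normalized.
have B := block_pos n t f g; have {}IH := IH n l2 ltac:(lia) szl2.
rewrite all_cat; split.
- by case=> /IH -> *; rewrite andbT; apply/B.
- by move=> /andP[/B[? ? ?] /IH].
Qed.

Lemma block_exists n u0 v0 : normalized n u0 v0 ->
  (forall c, (n < c)%N -> u0 c = 0) -> (forall c, (n.+1 < c)%N -> v0 c = 0) ->
  (forall c, (1 <= c <= n.+1)%N -> 0 < v0 c) ->
  (forall c, (c <= n)%N -> 0 < omega u0 v0 c) ->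
  exists f g, u0 = block_vec n f g (evec R n) /\ v0 = block_vec n f g (evec R n.+1).
Proof.
move=> [v00 v0n u0n u0n1] u0S v0S v0_gt0 w_gt0.
(* As [block_v0] dictates, the second run has the ratios of [v0] as parameters. Undoing it on [u0]
   leaves [x1], whose ratios are the parameters of the first run. *)
pose g c := v0 c.-1 / v0 c.
pose x1 c := u0 c - (if (2 <= c.+1 <= n.+1)%N then g c.+1 * u0 c.+1 else 0).
have x1E c : (c <= n)%N -> x1 c = omega u0 v0 c / v0 c.+1.
  move=> cn; have v0c : v0 c.+1 != 0 by rewrite gt_eqF ?v0_gt0.
  rewrite /x1 /g /omega; case: ifP => H /=; first by field.
  have c0 : c = 0%N by lia.
  by rewrite c0 in v0c *; rewrite v00; field.
have x1_neq0 c : (c <= n)%N -> x1 c != 0.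
  by move=> cn; rewrite x1E // gt_eqF // divr_gt0 ?w_gt0 ?v0_gt0.
pose f c := x1 c.-1 / x1 c.
exists f, g; split; apply/esym; rewrite /block_vec.
  rewrite (vops_run_eq (f := f) (y := x1)) => [|c].
    by apply: vops_run_eq => c; rewrite /x1 subrK.
  rewrite /evec; case: ifP => H.
    by rewrite (ltn_eqF (_ : c < _)%N) ?add0r /f /= ?divfK ?x1_neq0 //; lia.
  rewrite addr0; case: eqP => [->|cn].
    by rewrite /x1 u0n1 u0n mulr0 if_same subr0.
  by rewrite /x1 !u0S ?mulr0 ?if_same ?subr0 //; lia.
rewrite (vops_run_eq (f := f) (y := evec R n.+1)) => [|c]; last first.
  by case: ifP; rewrite ?addr0 // /evec => H; rewrite (ltn_eqF (_ : c.+1 < _)%N) ?mulr0 ?addr0 //; lia.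
apply: vops_run_eq => c; rewrite /evec; case: ifP => H.
  rewrite (ltn_eqF (_ : c < _)%N) ?add0r /g /= ?divfK //; last by lia.
  by rewrite gt_eqF // v0_gt0 //; lia.
rewrite addr0; case: eqP => [->//|cn].
have [->//|c0] := posnP c; apply: v0S; lia.
Qed.

(** The first two columns determine [t], [u] and [v], and the Schur complement is realized by
    induction. Only then are the congruences known that must be undone on [u] and [v] to recover the
    block. *)
Lemma TPseq_exists n F :
  (forall a b, F b a = - F a b) -> (forall a b, (n <= a)%N -> F a b = 0) ->
  Mpos n F -> exists l, [/\ size l = 'C(n, 2), all (>%R^~ 0) l & F = TPseq n l].
Proof.
have [k] := ubnP n; elim: k n F => // k IH [|[|n]] F nk Fskew Fsupp MF.
- exists [::]; split=> //; apply/funext2 => a b; exact: Fsupp.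
- exists [::]; split=> //; apply/funext2 => -[|a] b; rewrite ?(Fsupp a.+1) //.
  case: b => [|b]; last by rewrite Fskew Fsupp ?oppr0.
  by have := Fskew 0%N 0%N; rewrite /TPseq /=; lra.
have F0 a : F a a = 0 by have := Fskew a a; lra.
have Fn1 : 0 < F n.+1 0%N.
  have := MF n.+1 n.+1; rewrite /Mf; have -> : (n.+2 - n.+1 = 1)%N by lia.
  by rewrite minor_row1 // minor0 mulr1 /=; apply; lia.
(* For n > 0 these signs come from the minors with j = n and k = n or n + 1; for n = 0 from [F 1 0]
   alone. *)
have [F10 D0] : 0 < F 1%N 0%N /\ 0 < F n.+1 1%N * F n 0%N - F n 1%N * F n.+1 0%N.
  have [n0|n0] := posnP n.
    move: Fn1; rewrite n0 F0 (Fskew 1%N 0%N) => F1; split=> //.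
    nra.
  have := MF n n; have := MF n n.+1.
  rewrite /Mf; have -> : (n.+2 - n = 2)%N by lia.
  have -> : (n.+2 - n.+1 - 1 = 0)%N by lia.
  have -> : (2 - 1 = 1)%N by lia.
  rewrite !minor_row2 // !minor0 !mulr1 /= F0 add0n add1n.
  move=> /(_ ltac:(lia) ltac:(lia)) D1 /(_ ltac:(lia) ltac:(lia)) D2.
  by have := Fskew 1%N 0%N; split; nra.
(* Since [v] must vanish at 0, column 0 is a multiple of it. The combination of columns 0 and 1
   vanishing in row n + 1 is a multiple of [u]. Scaling is by [normalized], and [d] is t v_1. *)
pose v a := F a 0%N / F n.+1 0%N.
pose d := F n.+1 1%N * v n - F n 1%N.
pose u a := (F n.+1 1%N * v a - F a 1%N) / d.
pose t := d / v 1%N.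
have Fn1' : F n.+1 0%N != 0 by rewrite gt_eqF.
have d0 : d != 0.
  have -> : d = (F n.+1 1%N * F n 0%N - F n 1%N * F n.+1 0%N) / F n.+1 0%N.
    by rewrite /d /v; field.
  by rewrite mulf_neq0 ?invr_eq0 ?gt_eqF.
have F10' : F 1%N 0%N != 0 by rewrite gt_eqF.
have v0 : v 0%N = 0 by rewrite /v F0 mul0r.
have vn : v n.+1 = 1 by rewrite /v divff.
have un1 : u n.+1 = 0 by rewrite /u vn mulr1 subrr mul0r.
have un : u n = 1 by rewrite /u divff.
have uS c : (n.+1 < c)%N -> u c = 0.
  by move=> nc; rewrite /u /v !(Fsupp c) // !(mul0r, mulr0, subr0).
have vS c : (n.+1 < c)%N -> v c = 0 by move=> nc; rewrite /v (Fsupp c) // mul0r.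
pose C a b := F a.+2 b.+2 - wedge t u v a.+2 b.+2.
have wedgeN a b : wedge t u v b a = - wedge t u v a b by rewrite /wedge; ring.
have FE : F = fun a b => wedge t u v a b + shiftm C a b.
  have F_0 a : F a 0%N = wedge t u v a 0%N.
    rewrite /wedge v0 mulr0 subr0 /t /u v0 mulr0 sub0r -(Fskew 0%N 1%N) /v.
    by field; rewrite d0 Fn1' F10'.
  have F_1 a : F a 1%N = wedge t u v a 1%N.
    rewrite /wedge /t /u F0 subr0; have v1 : v 1%N != 0 by rewrite mulf_neq0 ?invr_eq0.
    by field; rewrite d0 v1.
  apply/funext2 => -[|[|a]] [|[|b]] /=; rewrite ?addr0 ?F_0 ?F_1 //.
  - by rewrite Fskew F_0 -wedgeN.
  - by rewrite Fskew F_1 -wedgeN.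
  - by rewrite /C addrC subrK.
have MC : Mpos n C.
  move=> j k' jk kn; have := MF j k'; rewrite FE Mf_Schur // => H.
  (* The factor is a square, so it suffices that its base does not vanish. *)
  have := H jk ltac:(lia); rewrite pmulr_rgt0 // exprn_even_gt0 //=.
  have v1 : v 1%N != 0 by rewrite mulf_neq0 ?invr_eq0.
  have u0 : u 0%N != 0.
    by rewrite /u v0 mulr0 sub0r -(Fskew 0%N 1%N) mulf_neq0 ?invr_eq0.
  by rewrite mulf_neq0 // mulf_neq0 // /t mulf_neq0 ?invr_eq0.
have Cskew a b : C b a = - C a b by rewrite /C wedgeN Fskew; ring.
have Csupp a b : (n <= a)%N -> C a b = 0.
  by move=> na; rewrite /C /wedge (Fsupp a.+2) ?(uS a.+2) ?(vS a.+2) //; ring.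
have [l2 [szl2 l2_gt0 CE]] := IH n C ltac:(lia) Cskew Csupp MC.
set S := shifts (congs n l2); have SP := @shifts_congs_range _ n l2.
have [u0 u0E] := vops_surj S u; have [v0' v0E] := vops_surj S v.
have hi x c : (n < c)%N -> vops S x c = x c.
  by move=> nc; rewrite vops_fix // => p /SP; lia.
have u0n1 : u0 n.+1 = 0 by rewrite -un1 -u0E hi.
(* The moves of [S] fix coordinates 0 and n + 1, and also coordinate n of [u0], because [u0]
   vanishes at n + 1. *)
have nuv : normalized n u0 v0'.
  split; rewrite ?u0n1 //.
  - by rewrite -v0 -v0E vops_shifts_low.
  - by rewrite -vn -v0E hi.
  - by rewrite -un -u0E vops_fix_last // => p /SP; lia.
have FE' : F = fun a b => wedge t (vops S u0) (vops S v0') a b + shiftm (TPseq n l2) a b.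
  by rewrite u0E v0E -CE.
have [_ t0 v0_gt0 w_gt0] : [/\ Mpos n (TPseq n l2), 0 < t,
    forall c, (1 <= c <= n.+1)%N -> 0 < v0' c &
    forall c, (c <= n)%N -> 0 < omega u0 v0' c].
  by apply/(Mpos_rec t szl2 nuv); rewrite -FE'.
have u0S c : (n < c)%N -> u0 c = 0.
  rewrite leq_eqVlt => /predU1P[<-//|nc].
  by rewrite -hi ?u0E ?uS //; lia.
have v0S c : (n.+1 < c)%N -> v0' c = 0.
  by move=> nc; rewrite -hi ?v0E ?vS //; lia.
have [f [g [u0E' v0E']]] := block_exists nuv u0S v0S v0_gt0 w_gt0.
exists (block_seq n t f g ++ l2); split.
- rewrite size_cat szl2 /= size_cat !size_map !size_decrun !binS bin1 bin0; lia.
- by rewrite all_cat l2_gt0 andbT; apply/block_pos; rewrite -u0E' -v0E'.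
- by rewrite TPseq_rec -u0E' -v0E'.
Qed.


End Positivity.

(** * Matrices and the product of generators *)

Section Bridge.
Variables (R : realType) (n : nat).
Implicit Types (F : nat -> nat -> R) (s : seq (nat * R)).

Definition mx_of F : 'M[R]_n := \matrix_(a, b) ((-1) ^+ (a + b) * F a b).

Definition coefs (A : 'M[R]_n) : nat -> nat -> R :=
  fun a b => (-1) ^+ (a + b) * mxget A a b.

Lemma mxgetE (A : 'M[R]_n) (a b : 'I_n) : mxget A a b = A a b.
Proof. by rewrite /mxget !valK. Qed.

Lemma coefsK A : mx_of (coefs A) = A.
Proof.
by apply/matrixP => a b; rewrite mxE /coefs mxgetE mulrA -expr2 sqrr_sign mul1r.
Qed.

Lemma coefs_skew A : skew_symmetric A -> forall a b, coefs A b a = - coefs A a b.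
Proof.
move=> /matrixP sk a b; rewrite /coefs /mxget addnC.
case: insubP => [a' _ _|_]; case: insubP => [b' _ _|_]; rewrite ?mulr0 ?oppr0 //.
by have := sk b' a'; rewrite !mxE => ->; rewrite mulrN.
Qed.

Lemma coefs_supp A a b : (n <= a)%N -> coefs A a b = 0.
Proof. by move=> na; rewrite /coefs /mxget insubN ?mulr0 // -leqNgt. Qed.

(** Row and column signs cancel on the unshifted rows. Each of the k + 1 - j shifted rows
    contributes (-1)^j, and j (k + 1 - j) has the parity of j k. *)
Lemma Mjk_coefs A j k : (1 <= j <= k)%N -> (k < n)%N -> Mjk j k A = Mf n j k (coefs A).
Proof.
move=> jk kn; rewrite /Mf /minor /Mjk.
pose r p := if (p < n - k - 1)%N then p else (p + j)%N.
set M := \matrix_(p, q) _; set M' := \matrix_(p, q) _.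
have -> : M' = diag_mx (\row_(p < n - j) (-1) ^+ r p) *m M *m
               diag_mx (\row_(p < n - j) (-1) ^+ p).
  apply/matrixP => p q; rewrite mul_mx_diag mul_diag_mx !mxE /coefs -/(r p).
  by rewrite exprD; ring.
rewrite !det_mulmx !det_diag mulrAC; congr (_ * _).
rewrite -big_split /=.
under eq_bigr => p _ do rewrite !mxE -exprD.
rewrite -(big_mkord xpredT (fun p => (-1) ^+ (r p + p))) /=.
rewrite (big_cat_nat (n := n - k - 1)) //=; last by lia.
rewrite big_nat_cond big1 ?mul1r => [|p /andP[/andP[_ H] _]]; last first.
  by rewrite /r H addnn -mul2n exprM sqrrN expr1n expr1n.
rewrite big_nat_cond (eq_bigr (fun _ => (-1) ^+ j)) => [|p /andP[/andP[H _] _]]; last first.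
  by rewrite /r ltnNge H /= addnAC addnn -mul2n exprD exprM sqrrN expr1n expr1n mul1r.
rewrite -big_nat_cond prodr_const_nat -exprM -[LHS]signr_odd -[RHS]signr_odd.
have -> : (n - j - (n - k - 1) = k.+1 - j)%N by lia.
rewrite !oddM oddB; last by lia.
by rewrite /=; case: (odd j); case: (odd k).
Qed.

Lemma mx_of_skew F : (forall a b, F b a = - F a b) -> skew_symmetric (mx_of F).
Proof. by move=> H; apply/matrixP => a b; rewrite !mxE H addnC mulrN. Qed.

Definition emx (i : nat) : 'M[R]_n := \matrix_(a, b) ((a.+1 == i) && (b == i :> nat))%:R.

Definition bmx : 'M[R]_n := \matrix_(a, b)
  (((a.+2 == n) && (b.+1 == n))%:R - ((a.+1 == n) && (b.+2 == n))%:R).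

Lemma emx_mul i (A : 'M[R]_n) (a b : 'I_n) (i' : 'I_n) : i' = i :> nat ->
  (emx i *m A) a b = (a.+1 == i)%:R * A i' b.
Proof.
move=> ii; rewrite mxE (bigD1 i') //= !mxE ii eqxx andbT big1 ?addr0 // => c ci.
by rewrite mxE -ii (negbTE (ci : c != i' :> nat)) andbF mul0r.
Qed.

Lemma emx_unipotent i t : (i < n)%N -> (1%:M + t *: emx i) *m (1%:M - t *: emx i) = 1%:M.
Proof.
move=> ni; have ee : emx i *m emx i = 0.
  apply/matrixP => a b; rewrite (emx_mul _ _ _ (_ : Ordinal ni = i :> nat)) // !mxE /=.
  by rewrite (gtn_eqF (ltnSn i)) mulr0.
rewrite mulmxDl !mulmxBr !mul1mx !mulmx1 -scalemxAl -scalemxAr ee !scaler0 subr0.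
by rewrite subrK.
Qed.

Lemma xgenE i t : (0 < i < n)%N ->
  xgen n i t = block_mx (1%:M + t *: emx i) 0 0 (1%:M - t *: (emx i)^T).
Proof.
move=> Hi; rewrite /xgen ifF; last by lia.
apply/matrixP => a b; case: (split_ordP a) => a' ->; case: (split_ordP b) => b' ->;
  rewrite ?(block_mxEul, block_mxEur, block_mxEdl, block_mxEdr) !mxE -!val_eqE /=;
  have := ltn_ord a'; have := ltn_ord b'; rewrite !eqSS -?addnS ?eqn_add2l ?eqSS => bn an.
- have -> : (a'.+1 == n + i.+1)%N = false by lia.
  by rewrite mulr0 subr0.
- have -> : (a' == n + b' :> nat)%N = false by lia.
  have -> : (n + b' == i)%N = false by lia.
  have -> : (a'.+1 == n + i.+1)%N = false by lia.
  by rewrite andbF mulr0 addr0 subr0.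
- have -> : (n + a' == b' :> nat)%N = false by lia.
  have -> : (n + a'.+1 == i)%N = false by lia.
  have -> : (b'.+1 == n + i)%N = false by lia.
  by rewrite andbF mulr0 addr0 subr0.
- have -> : (n + b' == i)%N = false by lia.
  by rewrite andbF mulr0 addr0 andbC.
Qed.

Lemma xgen_lastE t : (1 < n)%N -> xgen n n t = block_mx 1%:M (t *: bmx) 0 1%:M.
Proof.
move=> n1; rewrite /xgen eqxx.
apply/matrixP => a b; case: (split_ordP a) => a' ->; case: (split_ordP b) => b' ->;
  rewrite ?(block_mxEul, block_mxEur, block_mxEdl, block_mxEdr) !mxE -!val_eqE /=;
  have := ltn_ord a'; have := ltn_ord b'; rewrite -?addnS ?eqn_add2l => bn an.
- have -> : (b'.+1 == n + n)%N = false by lia.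
  have -> : (b'.+1 == (n + n).-1)%N = false by lia.
  by rewrite !andbF !mulr0 addr0 subr0.
- have -> : (a' == n + b' :> nat)%N = false by lia.
  have -> : (n + b'.+1 == (n + n).-1)%N = (b'.+2 == n) by lia.
  have -> : (a'.+1 == n.-1) = (a'.+2 == n) by lia.
  by rewrite add0r mulrBr.
- have -> : (n + a' == b' :> nat)%N = false by lia.
  have -> : (n + a'.+1 == n.-1)%N = false by lia.
  have -> : (n + a'.+1 == n)%N = false by lia.
  by rewrite !mulr0 addr0 subr0.
- have -> : (n + a'.+1 == n.-1)%N = false by lia.
  have -> : (n + a'.+1 == n)%N = false by lia.
  by rewrite !mulr0 addr0 subr0.
Qed.

Lemma mx_of_mop_last t F : (1 < n)%N -> mx_of (mop n (n, t) F) = mx_of F + t *: bmx.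
Proof.
move=> n1; rewrite /mop /= eqxx; apply/matrixP => a b; rewrite !mxE.
have [/andP[/eqP a1 /eqP b1]|_] := boolP ((a.+1 == n) && (b.+2 == n)).
  have -> : (a.+2 == n) = false by lia.
  have odd_ab : odd (a + b) by lia.
  by rewrite -signr_odd odd_ab /= expr1; ring.
have [/andP[/eqP a1 /eqP b1]|_] := boolP ((a.+2 == n) && (b.+1 == n)); last by ring.
have odd_ab : odd (a + b) by lia.
by rewrite -signr_odd odd_ab /= expr1; ring.
Qed.

Lemma mx_of_vop i t F : (0 < i < n)%N ->
  mx_of (fun a b => vop (i, t) (F^~ b) a) = (1%:M - t *: emx i) *m mx_of F.
Proof.
move=> /andP[i0 ni]; rewrite mulmxBl mul1mx -scalemxAl; apply/matrixP => a b.
rewrite [RHS]mxE [X in _ = _ + X]mxE [X in _ = _ - X]mxE.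
rewrite (emx_mul _ _ _ (_ : Ordinal ni = i :> nat)) // !mxE /vop /=.
case: eqP => [<-|_]; rewrite ?mul0r ?mulr0 ?subr0 ?addr0 //.
by rewrite addSn exprS mul1r mulN1r mulNr; ring.
Qed.

Lemma mx_of_tr F : mx_of (fun a b => F b a) = (mx_of F)^T.
Proof. by apply/matrixP => a b; rewrite !mxE addnC. Qed.

Lemma mx_of_mop i t F : (0 < i < n)%N ->
  mx_of (mop n (i, t) F) = (1%:M - t *: emx i) *m mx_of F *m (1%:M - t *: (emx i)^T).
Proof.
move=> Hi; rewrite /mop /= ifF; last by lia.
have -> : 1%:M - t *: (emx i)^T = (1%:M - t *: emx i)^T.
  by apply/matrixP => a b; rewrite !mxE [b == a]eq_sym.
pose G a b := vop (i, t) (F^~ b) a.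
rewrite -(mx_of_vop t F Hi) -/G.
rewrite (mx_of_tr (fun a b => vop (i, t) ((fun c d => G d c)^~ b) a)).
by rewrite mx_of_vop // (mx_of_tr G) trmx_mul trmxK.
Qed.

(** Multiplying [U | U A] by diag(g, g^-T) gives [U g | (U g)(g^-1 A g^-T)], a congruence on A;
    multiplying by x_n(t) adds t [bmx] to A. *)
Lemma usubmx_xprod s : (1 < n)%N -> (forall p, p \in s -> (0 < p.1 <= n)%N) ->
  exists2 U : 'M[R]_n, U \in unitmx &
  usubmx (\prod_(p <- s) xgen n p.1 p.2) =
  row_mx U (U *m mx_of (mops n s (fun _ _ => 0))).
Proof.
move=> n1; elim/last_ind: s => [|s [i t] IH] H.
  exists 1%:M; rewrite ?unitmx1 // big_nil -[1]/(1%:M) scalar_mx_block block_mxEv col_mxKu.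
  by rewrite mul1mx; congr row_mx; apply/matrixP => a b; rewrite !mxE mulr0.
have [|U Uu UE] := IH; first by move=> p ps; apply: H; rewrite mem_rcons inE ps orbT.
have := H (i, t); rewrite mem_rcons mem_head => /(_ isT) /= Hi.
rewrite big_rcons -[X in usubmx X]/(_ *m _) -mul_usub_mx UE /mops foldl_rcons -/(mops n s _) /=.
have [->|ni] := eqVneq i n.
  exists U => //; rewrite xgen_lastE // mul_row_block !mulmx1 !mulmx0 addr0.
  by rewrite mx_of_mop_last // mulmxDr addrC.
have {}Hi : (0 < i < n)%N by lia.
have eU : (1%:M + t *: emx i) *m (1%:M - t *: emx i) = 1%:M by apply: emx_unipotent; lia.
exists (U *m (1%:M + t *: emx i)).
  by rewrite unitmx_mul Uu; have [] := mulmx1_unit eU.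
rewrite xgenE // mul_row_block !mulmx0 addr0 add0r mx_of_mop //.
by congr row_mx; rewrite !mulmxA -(mulmxA U (1%:M + _)) eU mulmx1.
Qed.

Lemma Amat_TPseq (t : 'I_'C(n, 2) -> R) : (1 < n)%N ->
  Amat t = mx_of (TPseq n [seq t k | k <- enum 'I_'C(n, 2)]).
Proof.
move=> n1; set s := zip (word n) [seq t k | k <- enum 'I_'C(n, 2)].
have sE : s = [seq (nth 0%N (word n) k, t k) | k : 'I_'C(n, 2) <- enum 'I_'C(n, 2)].
  have szt : size [seq t k | k <- enum 'I_'C(n, 2)] = size (word n).
    by rewrite size_map size_enum_ord size_word.
  apply: (@eq_from_nth _ (0%N, 0)) => [|k].
    by rewrite size_zip szt minnn size_map size_enum_ord size_word.
  rewrite size_zip szt minnn size_word => kN; pose k' := Ordinal kN.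
  have kE : nth k' (enum 'I_'C(n, 2)) k = k' := nth_ord_enum k' k'.
  have kN' : (k < size (enum 'I_'C(n, 2)))%N by rewrite size_enum_ord.
  by rewrite nth_zip // (nth_map k' _ _ kN') (nth_map k' _ _ kN') kE.
have [p ps|U Uu UE] := @usubmx_xprod s n1.
  have : p.1 \in word n; last exact: mem_word.
  move: ps; rewrite sE => /mapP[k _ ->] /=; apply: mem_nth.
  by rewrite size_word.
rewrite /Amat /Umat /Rmat /Xmat /xprod.
have -> : \prod_(k < 'C(n, 2)) xgen n (nth 0%N (word n) k) (t k) =
  \prod_(p <- s) xgen n p.1 p.2.
  by rewrite sE big_map -deprecated_filter_index_enum big_filter.
by rewrite UE row_mxKl row_mxKr mulKmx.
Qed.

End Bridge.

(** * Polynomials positive on the orthant *)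

Section Orthant.
Variable R : realFieldType.

Lemma digits_inj N B (m m' : nat -> nat) :
  (forall k, (k < N)%N -> (m k < B)%N) -> (forall k, (k < N)%N -> (m' k < B)%N) ->
  (\sum_(k < N) m k * B ^ k = \sum_(k < N) m' k * B ^ k)%N ->
  forall k, (k < N)%N -> m k = m' k.
Proof.
elim: N m m' => [//|N IH] m m' mB m'B.
have E (h : nat -> nat) : (\sum_(k < N.+1) h k * B ^ k =
    (\sum_(k < N) h k.+1 * B ^ k) * B + h 0)%N.
  rewrite big_ord_recl expn0 muln1 addnC big_distrl /=; congr (_ + _)%N.
  by apply: eq_bigr => k _; rewrite expnSr mulnA.
have B0 : (0 < B)%N by have := mB 0%N isT; case: B {mB m'B E IH}.
rewrite !E => Emm.
have E0 : m 0%N = m' 0%N.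
  by have := congr1 (modn^~ B) Emm; rewrite !modnMDl !modn_small ?mB ?m'B.
move: Emm; rewrite E0 => /addIn /eqP; rewrite eqn_pmul2r // => /eqP Emm.
case=> [//|k]; rewrite ltnS.
exact: (IH (fun k => m k.+1) (fun k => m' k.+1) (fun i => mB i.+1)
  (fun i => m'B i.+1) Emm k).
Qed.

Definition wt N B (m : 'X_{1..N}) : nat := (\sum_(k < N) m k * B ^ k)%N.

(** Its sign is that of the monomial [m] on the orthant where exactly the coordinates marked by
    [eps] are negative. *)
Definition parity N (eps : 'I_N -> bool) (m : 'X_{1..N}) : bool :=
  \big[addb/false]_k (eps k && odd (m k)).

Definition curve N B (eps : 'I_N -> bool) (x : R) : 'I_N -> R :=
  fun k => (-1) ^+ eps k * x ^+ (B ^ k).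

Definition curve_poly N B (eps : 'I_N -> bool) (P : {mpoly R[N]}) : {poly R} :=
  \sum_(m <- msupp P) (P@_m * (-1) ^+ parity eps m) *: 'X^(wt B m).

Lemma curve_polyE N B eps (P : {mpoly R[N]}) x :
  (curve_poly B eps P).[x] = P.@[curve B eps x].
Proof.
rewrite mevalE /curve_poly horner_sum; apply: eq_bigr => m _.
rewrite hornerZ hornerXn -mulrA; congr (_ * _).
rewrite /parity /wt (big_morph _ (@signr_addb R) (erefl _)) -prodrXr -big_split /=.
apply: eq_bigr => k _; rewrite /curve exprMn -!exprM [(m k * _)%N]mulnC; congr (_ * _).
by rewrite -[RHS]signr_odd oddM oddb.
Qed.

(* The exponents [B ^ k] separate the monomials of [P], so the one of largest
   weight dominates along every curve, whatever the signs [eps] are. *)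
Lemma curve_lead N B (P : {mpoly R[N]}) : P != 0 ->
  (forall m k, m \in msupp P -> (m k < B)%N) ->
  exists m, P@_m != 0 /\
    forall eps, lead_coef (curve_poly B eps P) = P@_m * (-1) ^+ parity eps m.
Proof.
move=> P0 mB.
have [m0 m0P] : exists m0, m0 \in msupp P.
  case E: (msupp P) => [|m0 s]; last by exists m0; rewrite mem_head.
  by move: P0; rewrite -msupp_eq0 E.
have [m mP mmax] : exists2 m, m \in msupp P &
    forall m', m' \in msupp P -> (wt B m' <= wt B m)%N.
  have [i _ imax] := @arg_maxnP (seq_sub (msupp P)) (SeqSub m0P) xpredT
    (fun i => wt B (val i)) isT.
  exists (val i); first exact: valP.
  by move=> m' m'P; apply: (imax (SeqSub m'P)).
exists m; split; first by rewrite -mcoeff_msupp.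
move=> eps; set q := curve_poly B eps P.
have qm : q`_(wt B m) = P@_m * (-1) ^+ parity eps m.
  rewrite /q /curve_poly coef_sum (big_rem m) //= coefZ coefXn eqxx mulr1.
  rewrite big_seq big1 ?addr0 // => m' m'P.
  have m'P' : m' \in msupp P by apply: mem_rem m'P.
  rewrite coefZ coefXn; case: eqP => [Ew|_]; last by rewrite mulr0.
  suff mm' : m' = m by move: m'P; rewrite mm' mem_rem_uniqF ?msupp_uniq.
  apply/mnmP => k; pose ext (h : 'X_{1..N}) i := if insub i is Some j then h j else 0%N.
  have extE (h : 'X_{1..N}) (j : 'I_N) : ext h j = h j by rewrite /ext valK.
  rewrite -!extE; apply: (@digits_inj N B) => // [i iN|i iN|].
  - by rewrite -[i]/(val (Ordinal iN)) extE mB.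
  - by rewrite -[i]/(val (Ordinal iN)) extE mB.
  under eq_bigr do rewrite extE; under [RHS]eq_bigr do rewrite extE.
  by rewrite -/(wt B m) Ew.
have szq : size q = (wt B m).+1.
  apply/eqP; rewrite eqn_leq; apply/andP; split.
    apply: (leq_trans (size_sum _ _ _)); apply/bigmax_leqP_seq => m' m'P _.
    by apply: (leq_trans (size_scale_leq _ _)); rewrite size_polyXn ltnS mmax.
  rewrite ltnNge; apply/negP => /leq_sizeP /(_ _ (leqnn _)).
  by rewrite qm; apply/eqP; rewrite mulf_neq0 ?signr_eq0 // -mcoeff_msupp.
by rewrite lead_coefE szq.
Qed.

(** There are more sign patterns than vectors of r parities, so two patterns collide; parity being
    additive, their sum has all parities zero. *)
Lemma parity_kernel N r (m : 'I_r -> 'X_{1..N}) : (r < N)%N ->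
  exists eps : 'I_N -> bool, (exists k, eps k) /\ forall i, parity eps (m i) = false.
Proof.
move=> rN; pose phi (e : {ffun 'I_N -> bool}) := [ffun i => parity e (m i)].
have : ~~ injectiveb phi.
  apply/negP => /injectiveP /leq_card.
  by rewrite !card_ffun card_bool !card_ord leq_exp2l // leqNgt rN.
move=> /injectivePn[e [e' ee' Ephi]].
exists (fun k => e k (+) e' k); split.
  apply/existsP; apply: contraNT ee' => /existsPn H; apply/eqP/ffunP => k.
  by have := H k; case: (e k); case: (e' k).
move=> i; have := congr1 (fun h : {ffun _} => h i) Ephi; rewrite !ffunE => Ei.
have -> : parity (fun k => e k (+) e' k) (m i) = parity e (m i) (+) parity e' (m i).
  by rewrite /parity -big_split /=; apply: eq_bigr => k _; rewrite andb_addl.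
by rewrite Ei addbb.
Qed.

(** Positivity on the positive orthant forces a positive coefficient on each dominant monomial. The
    pattern of [parity_kernel] keeps all dominant terms positive in another orthant. *)
Lemma orthant_leak N r (P : 'I_r -> {mpoly R[N]}) : (r < N)%N ->
  (forall i t, (forall k, 0 < t k) -> 0 < (P i).@[t]) ->
  exists t : 'I_N -> R, (exists k, t k < 0) /\ forall i, 0 < (P i).@[t].
Proof.
move=> rN Ppos.
have P0 i : P i != 0.
  by apply/eqP => E; have := Ppos i (fun=> 1) (fun=> ltr01); rewrite E meval0 ltxx.
pose B := (\max_(i < r) msize (P i)).+1.
have mB i m k : m \in msupp (P i) -> (m k < B)%N.
  move=> /msize_mdeg_lt /= mP; rewrite ltnS.
  apply: leq_trans (leq_bigmax (F := fun i => msize (P i)) i).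
  by apply: leq_trans (ltnW mP); rewrite mdegE (bigD1 k) //= leq_addr.
have [m Hm] := fin_all_exists (fun i => curve_lead (P0 i) (@mB i)).
have mpos i : 0 < (P i)@_(m i).
  have [mi0 lead] := Hm i; rewrite lt_def mi0 /= leNgt; apply/negP => neg.
  have : 0 < lead_coef (- curve_poly B (fun=> false) (P i)).
    rewrite lead_coefN lead /parity big1 ?expr0 ?mulr1 ?oppr_gt0 //.
  (* The maximum with 1 makes x positive, so that the curve point lies in the positive orthant. *)
  move=> /poly_pinfty_gt_lc[c Hc]; have := Hc (Num.max c 1); rewrite le_max lexx => /(_ isT).
  rewrite hornerN curve_polyE lead_coefN lead /parity big1 // expr0 mulr1.
  move=> /(lt_le_trans _) -/(_ 0); rewrite oppr_gt0 => /(_ neg); rewrite oppr_gt0 ltNge.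
  rewrite ltW // Ppos // => k; rewrite /curve expr0 mul1r exprn_gt0 //.
  by rewrite lt_max ltr01 orbT.
have [eps [[k0 epsk0] eps0]] := parity_kernel m rN.
have /fin_all_exists[c Hc] i : exists c, forall x, c <= x -> 0 < (P i).@[curve B eps x].
  have [_ lead] := Hm i.
  have l0 : 0 < lead_coef (curve_poly B eps (P i)) by rewrite lead eps0 mulr1.
  have [c Hc] := poly_pinfty_gt_lc l0; exists c => x /Hc; rewrite curve_polyE.
  exact: lt_le_trans.
pose x := 1 + \sum_i `|c i|.
have cx i : c i <= x.
  rewrite /x (bigD1 i) //= addrCA; apply: le_trans (ler_norm _) _.
  by rewrite lerDl addr_ge0 // sumr_ge0.
have x0 : 0 < x by rewrite ltr_wpDr // sumr_ge0.
exists (curve B eps x); split=> [|i]; last exact: Hc.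
by exists k0; rewrite /curve epsk0 expr1 mulN1r oppr_lt0 exprn_gt0.
Qed.

(** * Polynomial dependence on the parameters *)

Definition polyfn N (h : ('I_N -> R) -> R) := exists P : {mpoly R[N]}, forall t, h t = P.@[t].

Lemma polyfn_cst N c : polyfn (fun _ : 'I_N -> R => c).
Proof. by exists c%:MP => t; rewrite mevalC. Qed.

Lemma polyfn_var N (k : 'I_N) : polyfn (fun t => t k).
Proof. by exists 'X_k => t; rewrite mevalXU. Qed.

Lemma polyfnD N (h1 h2 : ('I_N -> R) -> R) :
  polyfn h1 -> polyfn h2 -> polyfn (fun t => h1 t + h2 t).
Proof. by move=> [P1 H1] [P2 H2]; exists (P1 + P2) => t; rewrite mevalD H1 H2. Qed.

Lemma polyfnM N (h1 h2 : ('I_N -> R) -> R) :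
  polyfn h1 -> polyfn h2 -> polyfn (fun t => h1 t * h2 t).
Proof. by move=> [P1 H1] [P2 H2]; exists (P1 * P2) => t; rewrite mevalM H1 H2. Qed.

Lemma polyfn_comp N M (f : {mpoly R[M]}) (h : 'I_M -> ('I_N -> R) -> R) :
  (forall i, polyfn (h i)) -> polyfn (fun t => f.@[fun i => h i t]).
Proof.
move=> /fin_all_exists[P HP]; exists (f \mPo [tuple P i | i < M]) => t.
rewrite comp_mpoly_meval; apply: meval_eq => i.
by rewrite tnth_mktuple.
Qed.

Lemma polyfn_vop N i (a : nat) (c : ('I_N -> R) -> R) (x : ('I_N -> R) -> nat -> R) :
  polyfn c -> (forall a, polyfn (fun t => x t a)) ->
  polyfn (fun t => vop (i, c t) (x t) a).
Proof.
move=> Hc Hx; rewrite /vop /=; apply: polyfnD => //.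
by case: (a.+1 == i); [apply: polyfnM | apply: polyfn_cst].
Qed.

Lemma polyfn_mops N n (s : seq (nat * 'I_N)) a b :
  polyfn (fun t => mops n [seq (p.1, t p.2) | p <- s] (fun _ _ => 0) a b).
Proof.
elim/last_ind: s a b => [|s [i k] IH] a b; first exact: polyfn_cst.
have -> : (fun t : 'I_N -> R => mops n [seq (p.1, t p.2) | p <- rcons s (i, k)] (fun _ _ => 0) a b) =
  fun t => mop n (i, t k) (mops n [seq (p.1, t p.2) | p <- s] (fun _ _ => 0)) a b.
  by apply/funext => t; rewrite map_rcons /mops foldl_rcons.
have Hk := polyfn_var k.
have [->|ni] := eqVneq i n; last first.
  rewrite /mop /= (negbTE ni); apply: polyfn_vop => // a'; exact: polyfn_vop.
rewrite /mop /= eqxx; apply: polyfnD.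
  by apply: polyfnD => //; apply: polyfnM => //; apply: polyfn_cst.
under eq_fun do rewrite -mulrN.
by apply: polyfnM => //; apply: polyfn_cst.
Qed.

End Orthant.

(** * The number of test minors, skew-symmetry and the conclusion *)

Lemma card_index_pairs n : #|(fun jk : 'I_n * 'I_n => (1 <= jk.1 <= jk.2)%N)| = 'C(n, 2).
Proof.
rewrite -sum1_card.
rewrite -(pair_big_dep xpredT (fun j k : 'I_n => (1 <= j <= k)%N) (fun _ _ => 1%N)) /=.
(* With k outermost, exactly k values of j remain, and the sum of all k < n is the binomial
   coefficient. *)
rewrite (exchange_big_dep xpredT) //= -bin2_sum big_mkord; apply: eq_bigr => k _.
rewrite -(big_mkord (fun j => 1 <= j <= k)%N (fun _ => 1%N)).
transitivity (\sum_(1 <= j < k.+1) 1)%N; last by rewrite sum_nat_const_nat muln1 subn1.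
rewrite (big_nat_widen 1 k.+1 n) // (big_nat_widenl 1 0) //.
by apply: eq_bigl => j; rewrite ltnS andbC.
Qed.

Lemma mops_skew (R : realFieldType) n (s : seq (nat * R)) F :
  (forall a b, F b a = - F a b) -> forall a b, mops n s F b a = - mops n s F a b.
Proof.
elim: s F => [|p s IH] F skF //=; apply: IH => a b; rewrite /mop.
case: eqP => _; first by rewrite skF [(b.+1 == n) && _]andbC [(b.+2 == n) && _]andbC; ring.
have F0 c : F c c = 0 by have := skF c c; lra.
rewrite /vop; case: ifP => _; case: ifP => _;
  by rewrite ?F0 (skF a b) ?(skF p.1 a) ?(skF p.1 b); ring.
Qed.

Section Main.
Variables (R : realType) (n : nat).
Hypothesis n1 : (1 < n)%N.
Local Notation N := 'C(n, 2).
Implicit Types (A : 'M[R]_n) (t : 'I_N -> R).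

(** [coefs] of [mx_of] cuts [F] off outside the n x n square, which the test minors never leave. *)
Lemma Mpos_coefs (F : nat -> nat -> R) : Mpos n (coefs (mx_of n F)) <-> Mpos n F.
Proof.
have E j k : (1 <= j <= k)%N -> (k < n)%N -> Mf n j k (coefs (mx_of n F)) = Mf n j k F.
  move=> jk kn; apply: eq_minor => p q pj qj.
  set a := (if _ then _ else _); have an : (a < n)%N by rewrite /a; case: ifP; lia.
  have qn : (q < n)%N by lia.
  rewrite /coefs -[a]/(val (Ordinal an)) -[q]/(val (Ordinal qn)) mxgetE mxE.
  by rewrite mulrA -expr2 sqrr_sign mul1r.
by split=> H j k jk kn; have := H j k jk kn; rewrite E.
Qed.

(** Besides one direction of the criterion, this excludes that A(t) is totally positive for a
    non-positive [t] through some other parameters. *)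
Lemma Mpos_Amat t : Mpos n (coefs (Amat t)) <-> forall k, 0 < t k.
Proof.
have szt : size [seq t k | k <- enum 'I_N] = N by rewrite size_map size_enum_ord.
rewrite Amat_TPseq // Mpos_coefs (Mpos_TPseq szt).
split=> [/allP H k|H]; first by apply/H/map_f; rewrite mem_enum.
by apply/allP => _ /mapP[k _ ->]; exact: H.
Qed.

Lemma totally_positiveP A : skew_symmetric A -> totally_positive A <-> Mpos n (coefs A).
Proof.
move=> sk; split=> [[t [t0 ->]]|MA]; first exact/Mpos_Amat.
have [l [szl l0 AE]] := TPseq_exists (coefs_skew sk) (@coefs_supp _ _ A) MA.
exists (fun k => nth 0 l k); split=> [k|].
  by apply: (allP l0); rewrite mem_nth // szl.
rewrite -[A]coefsK AE Amat_TPseq //; congr (mx_of n (TPseq n _)).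
by rewrite -[LHS](mkseq_nth 0) szl /mkseq -val_enum_ord -map_comp.
Qed.

Lemma polyfn_Amat (f : {mpoly R[n * n]}) : polyfn (fun t => polyfun f (Amat t)).
Proof.
have -> : (fun t : 'I_N -> R => polyfun f (Amat t)) =
  (fun t => f.@[fun i => (fun i (t : 'I_N -> R) => mxvec (Amat t) 0 i) i t]) by [].
apply: polyfn_comp => i; case/mxvec_indexP: i => a b.
have -> : (fun t : 'I_N -> R => mxvec (Amat t) 0 (mxvec_index a b)) =
  fun t => (-1) ^+ (a + b) *
    mops n [seq (p.1, t p.2) | p <- zip (word n) (enum 'I_N)] (fun _ _ => 0) a b.
  apply/funext => t; rewrite mxvecE Amat_TPseq // mxE; congr (_ * mops n _ _ a b).
  by elim: (word n) (enum 'I_N) => [|i w IH] [|k s] //=; rewrite IH.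
by apply: polyfnM; [apply: polyfn_cst | apply: polyfn_mops].
Qed.

End Main.

Theorem theorem1p2 (R : realType) (n : nat) (hn : (2 <= n)%N) :
  (forall A : 'M[R]_n, skew_symmetric A ->
     (totally_positive A <->
      (forall j k : nat, (1 <= j)%N -> (j <= k)%N -> (k <= n - 1)%N ->
         0 < Mjk j k A)))
  /\ #|(fun jk : 'I_n * 'I_n => (1 <= jk.1 <= jk.2)%N)| = 'C(n, 2)
  /\ (forall (r : nat), (r < 'C(n, 2))%N ->
        forall f : 'I_r -> {mpoly R[n * n]},
        ~ (forall A : 'M[R]_n, skew_symmetric A ->
             (totally_positive A <-> forall i : 'I_r, 0 < polyfun (f i) A))).
Proof.
split; [|split; first exact: card_index_pairs].
  move=> A sk; rewrite totally_positiveP //; split=> [H j k j1 jk kn|H j k /andP[j1 jk] kn].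
    by rewrite Mjk_coefs ?H //; lia.
  by rewrite -Mjk_coefs ?H //; lia.
move=> r rN f Hf.
have Amat_skew (t : 'I_'C(n, 2) -> R) : skew_symmetric (Amat t).
  by rewrite Amat_TPseq //; apply/mx_of_skew/mops_skew => a b; rewrite oppr0.
have /fin_all_exists[P PE] i := polyfn_Amat hn (f i).
have [|t [[k tk] Pt]] := orthant_leak (P := P) rN.
  move=> i t t0; rewrite -PE; apply: (Hf _ (Amat_skew t)).1; by exists t.
(* The [f i] accept A(t) although a coordinate of [t] is negative, whereas the test minors force
   every coordinate to be positive. *)
have : totally_positive (Amat t).
  by apply: (Hf _ (Amat_skew t)).2 => i; rewrite PE.
move=> /(totally_positiveP hn (Amat_skew t))/(Mpos_Amat hn) /(_ k).
by rewrite ltNge ltW.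
Qed.
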